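(* For each $p\in(1,\infty)$ and each integer $d\ge1$, $$\|\mathcal{G}_*^{d+1}\|_{L^p(\mathbb{R}^{d+1})}\ge\|\mathcal{G}_*^{d}\|_{L^p(\mathbb{R}^{d})}.$$ Moreover, there exists a constant $c$ (independent of $p$) with $0.4<c\le1$ such that for all $p\in(1,\infty)$ $$\|\mathcal{G}_*^{1}\|_{L^p(\mathbb{R})}\ge\max\left\{c\,\frac{p}{p-1},\,1\right\}.$$ In particular, $\|\mathcal{G}_*^1\|_{L^p(\mathbb{R})}>\frac25\,\frac{p}{p-1}>1$ for all $p\in(1,\frac53)$.
   Context: For $t>0$ and $x\in\mathbb{R}^d$, $\mathcal{G}_t^df(x)=\frac{1}{(4\pi t)^{d/2}}\int_{\mathbb{R}^d}e^{-|y|^2/(4t)}f(x-y)\,dy$ (the heat semigroup on $\mathbb{R}^d$), and $\mathcal{G}_*^df(x)=\sup_{t>0}|\mathcal{G}_t^df(x)|$. The number $\|\mathcal{G}_*^d\|_{L^p(\mathbb{R}^d)}$ is the operator norm of $\mathcal{G}_*^d$ on $L^p(\mathbb{R}^d)$, i.e. the best constant in $\|\mathcal{G}_*^df\|_{L^p(\mathbb{R}^d)}\le\|\mathcal{G}_*^d\|_{L^p(\mathbb{R}^d)}\|f\|_{L^p(\mathbb{R}^d)}$, $f\in L^p(\mathbb{R}^d)$. *)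

(* Defs.v *)
From HB Require Import structures.
From mathcomp Require Import all_boot all_order all_algebra.
From mathcomp Require Import all_classical all_reals all_analysis.

Set Implicit Arguments.
Unset Strict Implicit.
Unset Printing Implicit Defensive.

Import Order.TTheory GRing.Theory Num.Theory.
Import numFieldNormedType.Exports.

Local Open Scope classical_set_scope.
Local Open Scope ring_scope.

(* R^d is [d.-tuple (measurableTypeR R)], with the product Borel
   sigma-algebra. *)
Notation euclidean R d := (d.-tuple (measurableTypeR R)).

Section cons_measure.
Context (R : realType) (n : nat).
Variable mu : {sigma_finite_measure set (euclidean R n) -> \bar R}.

Definition cons_pair (z : measurableTypeR R * euclidean R n) :
  euclidean R n.+1 := [the n.+1.-tuple _ of z.1 :: z.2].

Lemma measurable_cons_pair : measurable_fun [set: _] cons_pair.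
Proof.
apply: (@measurable_cons _ _ _ (measurableTypeR R) fst n snd);
  [exact: measurable_fst|exact: measurable_snd].
Qed.

(* The product of the Lebesgue measure on R and of mu, transported along
   R x R^n ~ R^(n+1). *)
Definition cons_measure : set (euclidean R n.+1) -> \bar R :=
  pushforward (lebesgue_measure \x mu)%E cons_pair.

Let cons_measure0 : cons_measure set0 = 0%E.
Proof. by rewrite /cons_measure /pushforward preimage_set0 measure0. Qed.

Let cons_measure_ge0 A : (0 <= cons_measure A)%E.
Proof. by rewrite /cons_measure /pushforward measure_ge0. Qed.

Let cons_measure_sigma_additive : semi_sigma_additive cons_measure.
Proof.
move=> F mF tF mUF; rewrite /cons_measure /pushforward preimage_bigcup.
have mc B : measurable B -> measurable (cons_pair @^-1` B).
  by move=> mB; rewrite -[X in measurable X]setTI; exact: measurable_cons_pair.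
apply: measure_semi_sigma_additive.
- by move=> k; exact: mc.
- apply/trivIsetP => /= i j _ _ ij; rewrite -preimage_setI.
  by move/trivIsetP : tF => /(_ _ _ _ _ ij) ->//; rewrite preimage_set0.
- by rewrite -preimage_bigcup; exact: mc.
Qed.

HB.instance Definition _ := isMeasure.Build _ _ _ cons_measure
  cons_measure0 cons_measure_ge0 cons_measure_sigma_additive.

Let split_pair (x : euclidean R n.+1) : measurableTypeR R * euclidean R n :=
  (thead x, [tuple of behead x]).

Let measurable_split_pair : measurable_fun [set: _] split_pair.
Proof.
apply: measurable_fun_pair; last exact: measurable_behead.
exact: (@measurable_tnth _ (measurableTypeR R)).
Qed.

Let cons_pairK : cancel cons_pair split_pair.
Proof.
by move=> [a t]; congr pair; exact/val_inj.
Qed.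

Let cons_measure_sigma_finite : sigma_finite setT cons_measure.
Proof.
have /sigma_finiteP[F [TF ndF Foo]] := sigma_finiteT (@lebesgue_measure R).
have /sigma_finiteP[G [TG ndG Goo]] := sigma_finiteT mu.
exists (fun k => split_pair @^-1` (F k `*` G k)).
  apply/esym; rewrite -subTset => x _.
  have [i _ Fi] : (\bigcup_k F k) (split_pair x).1 by rewrite -TF.
  have [j _ Gj] : (\bigcup_k G k) (split_pair x).2 by rewrite -TG.
  exists (maxn i j) => //; split.
    by move: Fi; exact/subsetPset/ndF/leq_maxl.
  by move: Gj; exact/subsetPset/ndG/leq_maxr.
move=> k; have [mF Fk] := Foo k; have [mG Gk] := Goo k.
split.
  rewrite -[X in measurable X]setTI; apply: measurable_split_pair => //.
  exact: measurableX.
rewrite /cons_measure /pushforward -comp_preimage.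
rewrite (_ : _ \o _ = id); last by apply/funext => z/=; rewrite cons_pairK.
by rewrite preimage_id product_measure1E// lte_mul_pinfty// ge0_fin_numE.
Qed.

HB.instance Definition _ := Measure_isSigmaFinite.Build _ _ _ cons_measure
  cons_measure_sigma_finite.

End cons_measure.

Fixpoint lebesgue_euclidean (R : realType) (d : nat) :
    {sigma_finite_measure set (euclidean R d) -> \bar R} :=
  if d is n.+1 then cons_measure (lebesgue_euclidean R n)
  else dirac ([tuple] : euclidean R 0).

Lemma lebesgue_euclidean_box (R : realType) (d : nat)
    (A : 'I_d -> set (measurableTypeR R)) :
  (forall i, measurable (A i)) ->
  lebesgue_euclidean R d [set x | forall i, A i (tnth x i)] =
  (\prod_(i < d) lebesgue_measure (A i))%E.
Proof.
elim: d A => [|d IHd] A mA.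
  rewrite big_ord0 /= diracE.
  by rewrite (_ : _ \in _ = true)//; apply/mem_set => -[].
rewrite big_ord_recl /= /cons_measure /pushforward.
pose B := [set x : euclidean R d | forall i, A (lift ord0 i) (tnth x i)].
have -> : cons_pair (n := d) @^-1` [set x | forall i, A i (tnth x i)] =
    A ord0 `*` B.
  apply/seteqP; split=> -[a t] /=.
    by move=> h; split; [exact: (h ord0)|move=> i; have := h (lift ord0 i); rewrite tnthS].
  by move=> [Aa Bt] i; have [j ->|->] := unliftP ord0 i; rewrite ?tnthS.
have mB : measurable B.
  rewrite (_ : B = \bigcap_(i in [set: 'I_d])
      ((fun x : euclidean R d => tnth x i) @^-1` A (lift ord0 i))).
    apply: fin_bigcap_measurable => // i _; rewrite -[X in measurable X]setTI.
    exact: (@measurable_tnth _ (measurableTypeR R)).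
  by apply/seteqP; split=> x Bx i; [move=> _|]; exact: Bx.
rewrite product_measure1E//; congr (_ * _)%E; exact: IHd.
Qed.

Section heat_semigroup.
Context (R : realType) (d : nat).
Implicit Types (x y : euclidean R d) (f : euclidean R d -> R).

Definition sub_euclidean x y : euclidean R d :=
  [tuple (tnth x i : R) - tnth y i | i < d].

Definition sqr_norm y : R := \sum_(i < d) (tnth y i : R) ^+ 2.

Definition heat_semigroup (t : R) f x : R :=
  ((4 * pi * t) `^ (d%:R / 2))^-1 *
  \int[lebesgue_euclidean R d]_y
     (expR (- sqr_norm y / (4 * t)) * f (sub_euclidean x y)).

Definition heat_maximal f x : \bar R :=
  ereal_sup [set `|heat_semigroup t f x|%:E | t in [set t : R | 0 < t]].

(* The best constant of the maximal inequality on L^p; it is +oo if there is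
   no admissible (finite) constant. *)
Definition heat_maximal_norm (p : R) : \bar R :=
  let mu := lebesgue_euclidean R d in
  ereal_inf [set C%:E | C in [set C : R | 0 <= C /\
    forall f, f \in Lfun mu p%:E ->
      ('N[mu]_(p%:E)[heat_maximal f] <= C%:E * 'N[mu]_(p%:E)[EFin \o f])%E]].

End heat_semigroup.

(* Main.v *)
Require Import Defs.
From HB Require Import structures.
From mathcomp Require Import all_boot all_order all_algebra.
From mathcomp Require Import all_classical all_reals all_analysis.
From mathcomp Require Import measurable_realfun ring lra.
Import Order.TTheory GRing.Theory Num.Theory.
Import numFieldNormedType.Exports.
Local Open Scope ring_scope.

(** Monotonicity in the dimension comes from tensoring with a very wide
    Gaussian.  If [g_L s = expR (- s^2 / 4L)], completing the square gives
    [G_t g_L = sqrt (L / (t + L)) g_(t+L) >= sqrt (L / (t + L)) g_L], so wide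
    Gaussians are almost invariant under the heat flow.  As the heat kernel is a
    product, for [h >= 0] the maximal function of [g_L(s) h(y)] is at least
    [g_L(s) M_L h(y)], where [M_L h] is the supremum over [t] of
    [sqrt (L / (t + L)) G_t h].  In a maximal inequality in dimension [d + 1]
    the factor [|g_L|_p] cancels, which leaves [|M_L h|_p <= C |h|_p] in
    dimension [d]; when [L] tends to infinity, [M_L h] increases to the maximal
    function of [h] (lemmas [heat_semigroup_tensor], [damped_maximal_bound] and
    [admissible_lower_dimension]).  In these integrals the supremum is taken
    over a countable set of times, to have measurable functions; nothing is
    lost because [t^(d/2) G_t h] is nondecreasing in [t].

    The argument also covers [d = 0], where the space is a point, the semigroup
    is the identity and the best constant is at least [1]; hence it is at least
    [1] in dimension [1].

    For the growth in [p] the test functions are [|x|^(-a)] restricted to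
    [|x| <= 1], with [a < 1/p].  At the point [x] and the time [x^2 / 2], fold
    the line at [0] and keep only [|y| <= |x|]: the two values of the Gaussian
    at [y] and [- y] add up to at least [3 / e] (lemma [gauss_pair_ge]), while
    the integral of [y^(-a)] up to [|x|] is [|x|^(1 - a) / (1 - a)].  So the
    maximal function is at least [c / (1 - a)] times the test function,
    pointwise, with [c = 3 / (e sqrt (2 pi))], which exceeds [0.4]; letting [a]
    tend to [1/p] gives [c p / (p - 1)]. *)

Set Implicit Arguments.
Unset Strict Implicit.
Unset Printing Implicit Defensive.
Local Open Scope classical_set_scope.
Local Open Scope ring_scope.

(** * Integration without measurability, and Lebesgue measure on R^d *)

(** The integral of a nonnegative function is the supremum of the integrals of
    the simple functions below it, so it is monotone even on nonmeasurable
    functions.  The maximal function, a supremum over uncountably many times, is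
    thus estimated without a proof of its measurability. *)
Lemma le_lower_integral d (T : measurableType d) (R : realType)
    (mu : {measure set T -> \bar R}) (f g : T -> \bar R) :
  (forall x, 0 <= f x)%E -> (forall x, f x <= g x)%E ->
  (\int[mu]_x f x <= \int[mu]_x g x)%E.
Proof.
move=> f0 fg; have g0 x : (0 <= g x)%E by exact: le_trans (fg x).
rewrite !ge0_integralTE//; apply: ge_ereal_sup => _ [h hf <-].
by apply: ereal_sup_ubound; exists h => // x; exact: le_trans (fg x).
Qed.

Lemma poweRK (R : realType) (p : R) (a : \bar R) : 0 < p -> (0 <= a)%E ->
  ((a `^ p) `^ p^-1)%E = a.
Proof. by move=> p0 a0; rewrite -poweRrM mulfV ?gt_eqF// poweRe1. Qed.

(** The power [1/p] is monotone, so a bound on the [p]-th powers of the elements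
    is a bound on the elements. *)
Lemma poweR_ereal_sup_le (R : realType) (p : R) (A : set (\bar R)) (b : \bar R) :
  0 < p -> (forall a, A a -> 0 <= a)%E -> A !=set0 ->
  (forall a, A a -> a `^ p <= b)%E -> ((ereal_sup A) `^ p <= b)%E.
Proof.
move=> p0 A0 [a0 Aa0] Ab.
have b0 : (0 <= b)%E by apply: le_trans (Ab _ Aa0); exact: poweR_ge0.
have bp : ((b `^ p^-1) `^ p = b)%E by rewrite -poweRrM mulVf ?gt_eqF// poweRe1.
rewrite -bp; apply: gt0_ler_poweR; first exact: ltW.
- rewrite in_itv/= leey andbT; apply: (le_trans (A0 _ Aa0)).
  exact: ereal_sup_ubound.
- by rewrite in_itv/= leey andbT poweR_ge0.
apply: ge_ereal_sup => a Aa.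
rewrite -(poweRK p0 (A0 _ Aa)).
apply: gt0_ler_poweR; rewrite ?in_itv/= ?leey ?poweR_ge0 ?invr_ge0 ?(ltW p0) ?b0//.
exact: Ab.
Qed.

Section euclidean_integral.
Context (R : realType).
Local Notation mu := (@lebesgue_measure R).

(** Tonelli's theorem, seen through the identification of [R^(n+1)] with
    [R x R^n] that defines the measure. *)
Lemma integral_cons (n : nat) (F : euclidean R n.+1 -> \bar R) :
  measurable_fun [set: euclidean R n.+1] F -> (forall x, 0 <= F x)%E ->
  (\int[lebesgue_euclidean R n.+1]_x F x =
   \int[mu]_s \int[lebesgue_euclidean R n]_y F (cons_pair (s, y)))%E.
Proof.
move=> mF F0.
transitivity (\int[mu \x lebesgue_euclidean R n]_z (F \o @cons_pair R n) z)%E.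
  rewrite [LHS](@ge0_integral_pushforward _ _ _ _ _ _
    (@measurable_cons_pair R n)) ?preimage_setT//.
rewrite fubini_tonelli1//=; last exact: measurableT_comp (@measurable_cons_pair R n).
Qed.

Lemma measurable_sqr_norm (d : nat) :
  measurable_fun [set: euclidean R d] (@sqr_norm R d).
Proof.
rewrite /sqr_norm; apply: measurable_sum => i; apply: measurable_funX.
exact: (@measurable_tnth _ (measurableTypeR R)).
Qed.

Lemma measurable_sub_euclidean (d : nat) :
  measurable_fun [set: euclidean R d * euclidean R d]
    (fun z => sub_euclidean z.1 z.2).
Proof.
apply/measurable_fun_tnthP => i.
rewrite (_ : _ \o _ = fun z : euclidean R d * euclidean R d =>
   (tnth z.1 i : R) - tnth z.2 i); last first.
  by apply/funext => z /=; rewrite tnth_mktuple.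
apply: measurable_funB; apply: (measurableT_comp (@measurable_tnth _ (measurableTypeR R) d i)).
  exact: measurable_fst.
exact: measurable_snd.
Qed.

Lemma measurable_sub_euclideanr (d : nat) (x : euclidean R d) :
  measurable_fun [set: euclidean R d] (sub_euclidean x).
Proof.
exact: (measurableT_comp (@measurable_sub_euclidean d) (pair1_measurable x)).
Qed.

Lemma measurable_cons_pairr (n : nat) (a : R) :
  measurable_fun [set: euclidean R n] (fun y => cons_pair (a, y)).
Proof.
exact: (measurableT_comp (@measurable_cons_pair R n) (pair1_measurable a)).
Qed.

Lemma sub_euclidean_cons (n : nat) (a b : R) (x y : euclidean R n) :
  sub_euclidean (cons_pair (a, x)) (cons_pair (b, y)) =
  cons_pair (a - b, sub_euclidean x y).
Proof.
apply: eq_from_tnth => i; rewrite tnth_mktuple /cons_pair /=.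
by have [j ->|->] := unliftP ord0 i; rewrite ?tnthS ?tnth0 ?tnth_mktuple.
Qed.

Lemma sqr_norm_cons (n : nat) (a : R) (x : euclidean R n) :
  sqr_norm (cons_pair (a, x)) = a ^+ 2 + sqr_norm x.
Proof.
rewrite /sqr_norm big_ord_recl/= tnth0; congr (_ + _).
by apply: eq_bigr => i _; rewrite tnthS.
Qed.

(** The image of the Lebesgue measure under [x |-> a - x] agrees with it on
    bounded half-open intervals, hence is equal to it.  Translations and the
    reflection at the origin are both covered. *)
Lemma integral_reflect (a : R) (f : R -> \bar R) :
  measurable_fun [set: _] f -> (forall x, 0 <= f x)%E ->
  (\int[mu]_x f (a - x)%R = \int[mu]_x f x)%E.
Proof.
move=> mf f0.
pose phi : measurableTypeR R -> measurableTypeR R := fun x => a - x.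
have mphi : measurable_fun setT phi.
  by apply: measurable_funB; [exact: measurable_cst|exact: measurable_id].
have := @ge0_integral_pushforward _ _ _ _ R phi mphi mu setT f measurableT mf (fun x _ => f0 x).
rewrite preimage_setT /= => <-.
apply: eq_measure_integral => A mA _; apply/esym.
pose nu := pushforward mu phi.
suff : forall X, ocitv X -> lebesgue_measure X = pushforward mu phi X.
  by move/lebesgue_measure_unique; apply.
move=> _ [[u v] /= _ <-]; rewrite /pushforward.
have -> : phi @^-1` `]u, v] = `[a - v, a - u[%classic.
  by apply/seteqP; split => x /=; rewrite /phi !in_itv/= => /andP[? ?]; apply/andP; split; lra.
rewrite !lebesgue_measure_itv/= !lte_fin ltrD2l ltrN2.
case: ifPn => // _; rewrite -!EFinB; congr EFin; ring.
Qed.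

Lemma integral_reflect_euclidean (d : nat) (x : euclidean R d)
    (f : euclidean R d -> \bar R) :
  measurable_fun [set: _] f -> (forall x, 0 <= f x)%E ->
  (\int[lebesgue_euclidean R d]_y f (sub_euclidean x y) =
   \int[lebesgue_euclidean R d]_y f y)%E.
Proof.
elim: d x f => [|n IH] x f mf f0.
  by apply: eq_integral => y _; congr f; rewrite [LHS]tuple0 [RHS]tuple0.
have msx : measurable_fun setT (fun y => f (sub_euclidean x y)).
  exact: measurableT_comp (measurable_sub_euclideanr x).
rewrite !integral_cons//.
have [a [x' ->]] : exists a x', x = cons_pair (a, x').
  exists (thead x), [tuple of behead x]; exact: tuple_eta.
under eq_integral => s _.
  under eq_integral => y _ do rewrite sub_euclidean_cons.
  rewrite (IH x' (fun y => f (cons_pair (a - s, y))))//; last first.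
    exact: measurableT_comp (measurable_cons_pairr (a - s)).
  over.
rewrite (integral_reflect a (f := fun s : R =>
  \int[lebesgue_euclidean R n]_y f (cons_pair (s, y)))%E)//.
- apply: (@measurable_fun_fubini_tonelli_F _ _ (measurableTypeR R) _ R
     (lebesgue_euclidean R n) (f \o @cons_pair R n)) => //=.
  exact: measurableT_comp (@measurable_cons_pair R n).
- by move=> s; exact: integral_ge0.
Qed.

End euclidean_integral.

(** * Gaussian integrals and finiteness of the heat integral *)

Section gaussian.
Context (R : realType).
Local Notation mu := (@lebesgue_measure R).

(** The normal density of mean [m] and standard deviation [sqrt (2 t)], without
    its normalising factor. *)
Lemma integral_gauss_line (m t : R) : 0 < t ->
  (\int[mu]_y (expR (- (y - m) ^+ 2 / (4 * t)))%:E =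
   (Num.sqrt (4 * pi * t))%:E)%E.
Proof.
move=> t0; pose s := Num.sqrt (2 * t).
have s2 : s ^+ 2 = 2 * t by rewrite sqr_sqrtr// mulr_ge0// ltW.
have s0 : s != 0 by rewrite gt_eqF// sqrtr_gt0 mulr_gt0.
have P0 : 0 < Num.sqrt (4 * pi * t) by rewrite sqrtr_gt0 !mulr_gt0// pi_gt0.
have pdfE y : expR (- (y - m) ^+ 2 / (4 * t)) =
    Num.sqrt (4 * pi * t) * normal_pdf m s y.
  rewrite normal_pdfE// /normal_peak /normal_fun s2.
  rewrite (_ : 2 * t * pi *+ 2 = 4 * pi * t); last by rewrite -mulr_natl; ring.
  rewrite mulrA mulfV ?gt_eqF// mul1r; congr expR; congr (_ / _).
  by rewrite -mulr_natl; ring.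
under eq_integral do rewrite pdfE EFinM.
rewrite ge0_integralZl_EFin ?integral_normal_pdf ?mule1//.
- by move=> x _; rewrite lee_fin normal_pdf_ge0.
- by apply/measurable_EFinP; exact: measurable_normal_pdf.
Qed.

(** The heat flow maps Gaussians to Gaussians: the integrand is a constant times
    a Gaussian in [y] centred at [s * t / (t + L)]. *)
Lemma integral_gauss_conv (t L s : R) : 0 < t -> 0 < L ->
  (\int[mu]_y (expR (- y ^+ 2 / (4 * t)) * expR (- (s - y) ^+ 2 / (4 * L)))%:E =
   (Num.sqrt (4 * pi * (t * L / (t + L))) * expR (- s ^+ 2 / (4 * (t + L))))%:E)%E.
Proof.
move=> t0 L0; have tL0 : 0 < t + L by rewrite addr_gt0.
have [tn Ln tLn] : [/\ t != 0, L != 0 & t + L != 0] by split; rewrite gt_eqF.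
have T0 : 0 < t * L / (t + L) by rewrite divr_gt0// mulr_gt0.
pose m := s * t / (t + L).
have sqE y : expR (- y ^+ 2 / (4 * t)) * expR (- (s - y) ^+ 2 / (4 * L)) =
  expR (- s ^+ 2 / (4 * (t + L))) *
  expR (- (y - m) ^+ 2 / (4 * (t * L / (t + L)))).
  rewrite -!expRD; congr expR; rewrite /m; field.
  by rewrite tn Ln tLn.
under eq_integral do rewrite sqE EFinM.
rewrite ge0_integralZl_EFin ?expR_ge0//.
- by rewrite integral_gauss_line// -EFinM mulrC.
- by apply/measurable_EFinP; apply: measurableT_comp => //; apply: measurable_funM => //;
    apply: measurable_funN; apply: measurable_funX; apply: measurable_funB.
Qed.

(** The heat kernel at time [t], without its normalising factor. *)
Definition gauss (d : nat) (t : R) (y : euclidean R d) : R :=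
  expR (- sqr_norm y / (4 * t)).

Lemma measurable_gauss d t : measurable_fun [set: euclidean R d] (gauss t).
Proof.
apply: measurableT_comp => //; apply: measurable_funM => //.
by apply: measurable_funN; exact: measurable_sqr_norm.
Qed.

Lemma gauss_ge0 d t (y : euclidean R d) : 0 <= gauss t y.
Proof. exact: expR_ge0. Qed.

Lemma sqr_norm_ge0 d (y : euclidean R d) : 0 <= sqr_norm y.
Proof. by apply: sumr_ge0 => i _; exact: sqr_ge0. Qed.

Lemma gauss_le1 d t (y : euclidean R d) : 0 < t -> gauss t y <= 1.
Proof.
move=> t0; rewrite -expR0 ler_expR mulNr oppr_le0 divr_ge0 ?sqr_norm_ge0//.
by rewrite mulr_ge0// ltW.
Qed.

Lemma gauss_cons d t (s : R) (y : euclidean R d) :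
  gauss t (cons_pair (s, y)) = expR (- s ^+ 2 / (4 * t)) * gauss t y.
Proof. by rewrite /gauss sqr_norm_cons -expRD opprD mulrDl. Qed.

(** The exponential turns the sum of squares into a product, so Tonelli's theorem
    reduces the claim to the Gaussian integral on the line. *)
Lemma integral_gauss_lty d t : 0 < t ->
  (\int[lebesgue_euclidean R d]_y (gauss t y)%:E < +oo)%E.
Proof.
move=> t0; elim: d => [|d IH].
  rewrite integral_dirac//=; first by rewrite diracT mul1e ltry.
  by apply/measurable_EFinP; exact: measurable_gauss.
rewrite integral_cons//=; last 2 first.
- by apply/measurable_EFinP; exact: measurable_gauss.
- by move=> x; rewrite lee_fin gauss_ge0.
have mg : measurable_fun [set: euclidean R d] (EFin \o gauss t).
  by apply/measurable_EFinP; exact: measurable_gauss.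
have I0 : (0 <= \int[lebesgue_euclidean R d]_y (gauss t y)%:E)%E.
  by apply: integral_ge0 => y _; rewrite lee_fin gauss_ge0.
under eq_integral => s _.
  under eq_integral => y _ do rewrite gauss_cons EFinM.
  rewrite ge0_integralZl_EFin ?expR_ge0//; last first.
    by move=> y _; rewrite lee_fin gauss_ge0.
  over.
rewrite ge0_integralZr//.
- under eq_integral => s _ do rewrite -[X in X ^+ 2]subr0.
  by rewrite integral_gauss_line// lte_mul_pinfty// lee_fin.
- by apply/measurable_EFinP; apply: measurableT_comp => //; apply: measurable_funM => //;
    apply: measurable_funN; apply: measurable_funX.
Qed.

End gaussian.

Lemma mem_LfunP d (T : measurableType d) (R : realType)
    (mu : {measure set T -> \bar R}) (p : R) (f : T -> R) : 0 < p ->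
  f \in Lfun mu p%:E <->
  measurable_fun [set: T] f /\ (\int[mu]_x (`|f x| `^ p)%:E < +oo)%E.
Proof.
move=> p0.
have nE : (\int[mu]_x (`|f x| `^ p)%:E = \int[mu]_x (`|(EFin \o f) x| `^ p))%E.
  by apply: eq_integral.
rewrite nE inE; split.
- move=> /andP[]; rewrite !inE => mf; rewrite /finite_norm => Nf; split => //.
  by rewrite -poweR_Lnorm ?gt_eqF// poweR_lty.
- move=> [mf If]; apply/andP; rewrite !inE/=; split => //.
  by rewrite /finite_norm unlock poweR_lty.
Qed.

Section heat_integral.
Context (R : realType) (d : nat).
Local Notation mu := (lebesgue_euclidean R d).
Implicit Types (f h : euclidean R d -> R) (t : R) (x y : euclidean R d).

(** The semigroup is defined with a real-valued integral, which is [0] when the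
    integral diverges.  For [h >= 0] the extended-real integral, without
    normalising factor, obeys Tonelli's theorem and is monotone in [t] whether
    or not it converges. *)
Definition heat_integral t h x : \bar R :=
  (\int[mu]_y (gauss t y * h (sub_euclidean x y))%:E)%E.

Lemma heat_integral_ge0 t h x : (forall y, 0 <= h y) ->
  (0 <= heat_integral t h x)%E.
Proof.
by move=> h0; apply: integral_ge0 => y _; rewrite lee_fin mulr_ge0 ?gauss_ge0.
Qed.

Lemma measurable_heat_integrand t h x : measurable_fun setT h ->
  measurable_fun [set: euclidean R d]
    (fun y => gauss t y * h (sub_euclidean x y)).
Proof.
move=> mh; apply: measurable_funM; first exact: measurable_gauss.
exact: measurableT_comp (measurable_sub_euclideanr x).
Qed.

Lemma measurable_heat_integral t h : measurable_fun setT h ->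
  (forall y, 0 <= h y) ->
  measurable_fun [set: euclidean R d] (heat_integral t h).
Proof.
move=> mh h0; apply: (@measurable_fun_fubini_tonelli_F _ _ _ _ R mu
  (fun z => (gauss t z.2 * h (sub_euclidean z.1 z.2))%:E)) => /=.
- apply/measurable_EFinP; apply: measurable_funM.
    by apply: measurableT_comp => //; exact: measurable_gauss.
  exact: measurableT_comp (@measurable_sub_euclidean R d).
- by move=> z; rewrite lee_fin mulr_ge0 ?gauss_ge0.
Qed.

Lemma le1_powRD (a p : R) : 0 <= a -> 1 <= p -> a <= 1 + a `^ p.
Proof.
move=> a0 p1; have [a1|a1] := leP a 1.
  by rewrite (le_trans a1)// lerDl powR_ge0.
rewrite (@le_trans _ _ (a `^ p))// ?lerDr//.
by rewrite -[leLHS]powRr1// ler_powR// ltW.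
Qed.

(** As the kernel lies between [0] and [1], the inequality [|f| <= 1 + |f|^p]
    bounds the integrand by the sum of the kernel and of a reflected copy of
    [|f|^p], both integrable. *)
Lemma heat_integral_lty p t f x : 1 <= p -> 0 < t -> f \in Lfun mu p%:E ->
  (heat_integral t (fun y => `|f y|%R) x < +oo)%E.
Proof.
move=> p1 t0 /mem_LfunP[|mf If]; first exact: lt_le_trans p1.
have mpf : measurable_fun [set: euclidean R d] (fun y => `|f y| `^ p).
  apply: (@measurableT_comp _ _ _ _ _ _ (@powR R ^~ p)) => //.
  exact: measurableT_comp.
apply: (@le_lt_trans _ _ (\int[mu]_y (gauss t y)%:E +
    \int[mu]_y (`|f (sub_euclidean x y)| `^ p)%:E)%E).
- rewrite -ge0_integralD//=.
  + apply: le_lower_integral => y; rewrite lee_fin ?mulr_ge0 ?gauss_ge0//.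
    apply: (@le_trans _ _ (gauss t y * (1 + `|f (sub_euclidean x y)| `^ p))).
      by rewrite ler_wpM2l ?gauss_ge0// le1_powRD.
    rewrite mulrDr mulr1 lerD2l ler_piMl ?powR_ge0//; exact: gauss_le1.
  + by move=> y _; rewrite lee_fin gauss_ge0.
  + by apply/measurable_EFinP; exact: measurable_gauss.
  + apply/measurable_EFinP.
    exact: (measurableT_comp mpf (measurable_sub_euclideanr x)).
- apply: lte_add_pinfty; first exact: integral_gauss_lty.
  rewrite (integral_reflect_euclidean x (f := fun y => (`|f y| `^ p)%:E))//.
    by apply/measurable_EFinP.
Qed.

Lemma heat_semigroupE t h x : (heat_integral t h x < +oo)%E ->
  (forall y, 0 <= h y) ->
  ((heat_semigroup t h x)%:E =
   (((4 * pi * t) `^ (d%:R / 2))^-1)%:E * heat_integral t h x)%E.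
Proof.
move=> hoo h0; rewrite /heat_semigroup EFinM /Rintegral fineK//.
by rewrite ge0_fin_numE ?heat_integral_ge0.
Qed.

Lemma heat_semigroup_ge0 t h x : (forall y, 0 <= h y) ->
  0 <= heat_semigroup t h x.
Proof.
move=> h0; rewrite mulr_ge0 ?invr_ge0 ?powR_ge0// Rintegral_ge0// => y _.
by rewrite mulr_ge0 ?expR_ge0.
Qed.

End heat_integral.

(** * The heat semigroup on products *)

Section tensor.
Context (R : realType) (n : nat).
Local Notation mu := (@lebesgue_measure R).
Local Notation mun := (lebesgue_euclidean R n).
Local Notation mun1 := (lebesgue_euclidean R n.+1).

(** The product operation is a parameter, so that real-valued test functions and
    extended-real integrands such as [p]-th powers of a maximal function are
    treated alike. *)
Definition tensor (T : Type) (op : T -> T -> T) (a : R -> T)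
    (b : euclidean R n -> T) (x : euclidean R n.+1) : T :=
  op (a (thead x)) (b [tuple of behead x]).

Lemma tensorE (T : Type) (op : T -> T -> T) a b s y :
  tensor op a b (cons_pair (s, y)) = op (a s) (b y).
Proof. by rewrite /tensor; congr (op _ (b _)); exact: val_inj. Qed.

Lemma measurable_theadR : measurable_fun [set: euclidean R n.+1] (fun x => thead x : R).
Proof. exact: (@measurable_tnth _ (measurableTypeR R)). Qed.

Lemma measurable_tensor_mule (a : R -> \bar R) (b : euclidean R n -> \bar R) :
  measurable_fun setT a -> measurable_fun setT b ->
  measurable_fun [set: euclidean R n.+1] (tensor *%E a b).
Proof.
move=> ma mb; apply: emeasurable_funM.
  exact: (measurableT_comp ma measurable_theadR).
exact: (measurableT_comp mb (@measurable_behead _ (measurableTypeR R) n)).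
Qed.

Lemma measurable_tensor (a : R -> R) (b : euclidean R n -> R) :
  measurable_fun setT a -> measurable_fun setT b ->
  measurable_fun [set: euclidean R n.+1] (tensor *%R a b).
Proof.
move=> ma mb; apply: measurable_funM.
  exact: (measurableT_comp ma measurable_theadR).
exact: (measurableT_comp mb (@measurable_behead _ (measurableTypeR R) n)).
Qed.

Lemma integral_tensor (a : R -> \bar R) (b : euclidean R n -> \bar R) :
  measurable_fun setT a -> measurable_fun setT b ->
  (forall s, 0 <= a s)%E -> (forall y, 0 <= b y)%E ->
  (\int[mun1]_x tensor *%E a b x = \int[mu]_s a s * \int[mun]_y b y)%E.
Proof.
move=> ma mb a0 b0.
rewrite integral_cons; last 2 first.
- exact: measurable_tensor_mule.
- by move=> x; rewrite mule_ge0.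
have I0 : (0 <= \int[mun]_y b y)%E by exact: integral_ge0.
under eq_integral => s _.
  under eq_integral => y _ do rewrite tensorE.
  rewrite ge0_integralZl//; over.
by rewrite ge0_integralZr.
Qed.

End tensor.

Section heat_tensor.
Context (R : realType) (d : nat).
Local Notation mu := (@lebesgue_measure R).
Implicit Types (h : euclidean R d -> R) (t L s : R) (y : euclidean R d).

Definition gauss_line L s : R := expR (- s ^+ 2 / (4 * L)).

Lemma gauss_line_ge0 L s : 0 <= gauss_line L s. Proof. exact: expR_ge0. Qed.

Lemma measurable_gauss_line L : measurable_fun [set: R] (gauss_line L).
Proof.
apply: measurableT_comp => //; apply: measurable_funM => //.
by apply: measurable_funN; exact: measurable_funX.
Qed.

(** The kernel on [R^(d+1)] is the product of the kernels on [R] and [R^d], so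
    the integral factors, and the factor on the line is a Gaussian convolution. *)
Lemma heat_integral_tensor t L h s y : 0 < t -> 0 < L ->
  measurable_fun setT h -> (forall y, 0 <= h y) ->
  (heat_integral t (tensor *%R (gauss_line L) h) (cons_pair (s, y)) =
   (Num.sqrt (4 * pi * (t * L / (t + L))) * gauss_line (t + L) s)%:E *
   heat_integral t h y)%E.
Proof.
move=> t0 L0 mh h0; rewrite -integral_gauss_conv//.
have mgl : measurable_fun [set: R] (fun u => gauss_line t u * gauss_line L (s - u)).
  apply: measurable_funM; first exact: measurable_gauss_line.
  by apply: (measurableT_comp (measurable_gauss_line L)); exact: measurable_funB.
rewrite -(@integral_tensor _ _ (fun u => (gauss_line t u * gauss_line L (s - u))%:E)
   (fun z => (gauss t z * h (sub_euclidean y z))%:E))//=.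
- apply: eq_integral => x _.
  have -> : x = cons_pair (thead x, [tuple of behead x]) by exact: tuple_eta.
  rewrite tensorE sub_euclidean_cons tensorE gauss_cons -EFinM /gauss_line.
  by congr EFin; ring.
- exact/measurable_EFinP.
- apply/measurable_EFinP; exact: measurable_heat_integrand.
- by move=> u; rewrite lee_fin mulr_ge0 ?gauss_line_ge0.
- by move=> z; rewrite lee_fin mulr_ge0 ?gauss_ge0.
Qed.

(** Up to the factor [sqrt (L / (t + L))], which tends to [1] as [L] grows, and a
    widening of the Gaussian, the extra variable does not see the heat flow. *)
Lemma heat_semigroup_tensor t L h s y : 0 < t -> 0 < L ->
  measurable_fun setT h -> (forall y, 0 <= h y) ->
  (heat_integral t h y < +oo)%E ->
  heat_semigroup t (tensor *%R (gauss_line L) h) (cons_pair (s, y)) =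
  Num.sqrt (L / (t + L)) * gauss_line (t + L) s * heat_semigroup t h y.
Proof.
move=> t0 L0 mh h0 hoo; apply: EFin_inj.
have T0 : forall x, 0 <= tensor *%R (gauss_line L) h x.
  by move=> x; rewrite mulr_ge0 ?gauss_line_ge0.
have tL0 : 0 < t + L by rewrite addr_gt0.
have pt0 : 0 < 4 * pi * t by rewrite !mulr_gt0 ?pi_gt0.
have hI0 := @heat_integral_ge0 _ _ t h y h0.
rewrite heat_semigroupE// ?heat_integral_tensor//; last first.
  by rewrite lte_mul_pinfty// lee_fin mulr_ge0 ?sqrtr_ge0 ?gauss_line_ge0.
rewrite [in RHS]EFinM heat_semigroupE// muleA -EFinM muleA -EFinM.
congr (_%:E * _)%E.
have -> : (d.+1%:R / 2 : R) = 2^-1 + d%:R / 2 by rewrite -add1n natrD mulrDl mul1r.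
rewrite powRD; last by rewrite gt_eqF ?implybT.
rewrite powR12_sqrt ?(ltW pt0)//.
have -> : 4 * pi * (t * L / (t + L)) = (4 * pi * t) * (L / (t + L)) by ring.
rewrite [Num.sqrt (4 * pi * t * (L / _))]sqrtrM ?(ltW pt0)//.
have S0 : Num.sqrt (4 * pi * t) != 0 by rewrite gt_eqF// sqrtr_gt0.
have P0 : (4 * pi * t) `^ (d%:R / 2) != 0 by rewrite gt_eqF// powR_gt0.
by field; rewrite S0 P0.
Qed.

Lemma gauss_line_le t L s : 0 <= t -> 0 < L -> gauss_line L s <= gauss_line (t + L) s.
Proof.
move=> t0 L0; rewrite ler_expR !mulNr lerN2 ler_wpM2l ?sqr_ge0//.
have tL0 : 0 < t + L by rewrite ltr_wpDl.
by rewrite lef_pV2 ?posrE ?mulr_gt0// ler_wpM2l// lerDr.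
Qed.

Lemma integral_gauss_lineX (p L : R) : 0 < p -> 0 < L ->
  (\int[mu]_s (gauss_line L s `^ p)%:E = (Num.sqrt (4 * pi * (L / p)))%:E)%E.
Proof.
move=> p0 L0; rewrite -(@integral_gauss_line R 0) ?divr_gt0//.
apply: eq_integral => s _; rewrite /gauss_line -expRM; congr (expR _)%:E.
by rewrite subr0; field; rewrite !gt_eqF.
Qed.

(** The kernel without normalising factor increases with time, and that factor is
    a power of the time; so a slightly later time loses almost nothing. *)
Lemma heat_semigroup_mono t s h y : 0 < t -> t <= s ->
  (forall y, 0 <= h y) -> (heat_integral s h y < +oo)%E ->
  (t / s) `^ (d%:R / 2) * heat_semigroup t h y <= heat_semigroup s h y.
Proof.
move=> t0 ts h0 hoo; have s0 : 0 < s by exact: lt_le_trans ts.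
have tsI : (heat_integral t h y <= heat_integral s h y)%E.
  apply: le_lower_integral => z; rewrite lee_fin; first by rewrite mulr_ge0 ?gauss_ge0.
  rewrite ler_wpM2r// ler_expR !mulNr lerN2 ler_wpM2l ?sqr_norm_ge0//.
  by rewrite lef_pV2 ?posrE ?mulr_gt0// ler_wpM2l.
rewrite -lee_fin EFinM !heat_semigroupE//; last exact: le_lt_trans tsI hoo.
rewrite muleA -EFinM.
have -> : (t / s) `^ (d%:R / 2) * ((4 * pi * t) `^ (d%:R / 2))^-1 =
    ((4 * pi * s) `^ (d%:R / 2))^-1.
  have ps0 : 0 < 4 * pi * s by rewrite !mulr_gt0 ?pi_gt0.
  have -> : 4 * pi * t = 4 * pi * s * (t / s) by field; rewrite gt_eqF.
  have ts0 : 0 < t / s by rewrite divr_gt0.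
  rewrite (powRM _ (ltW ps0) (ltW ts0)); field.
  by rewrite !gt_eqF ?powR_gt0.
by rewrite lee_wpmul2l// lee_fin invr_ge0 powR_ge0.
Qed.

End heat_tensor.

(** * Reduction of the maximal function to countably many times *)

(** The norms are compared through the integrals of [p]-th powers, on which
    Tonelli's theorem and monotone convergence act. *)
Lemma le_Lnorm_integral d (T : measurableType d) d' (U : measurableType d')
    (R : realType) (mu : {measure set T -> \bar R})
    (nu : {measure set U -> \bar R}) (p C : R)
    (u : T -> \bar R) (v : U -> \bar R) : 0 < p -> 0 <= C ->
  ('N[mu]_p%:E[u] <= C%:E * 'N[nu]_p%:E[v])%E =
  (\int[mu]_x (`|u x| `^ p) <= (C `^ p)%:E * \int[nu]_x (`|v x| `^ p))%E.
Proof.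
move=> p0 C0; have pn0 : p != 0 by rewrite gt_eqF.
rewrite -!poweR_Lnorm// -poweR_EFin -poweRM ?lee_fin ?Lnorm_ge0//.
have CN : (0 <= C%:E * 'N[nu]_p%:E[v])%E by rewrite mule_ge0 ?lee_fin ?Lnorm_ge0.
apply/idP/idP => [h|h].
  by apply: gt0_ler_poweR; rewrite ?in_itv/= ?leey ?Lnorm_ge0 ?CN// ltW.
rewrite -(poweRK p0 CN) -(poweRK p0 (Lnorm_ge0 _ _ _)).
by apply: gt0_ler_poweR; rewrite ?in_itv/= ?leey ?poweR_ge0 ?invr_ge0// ltW.
Qed.

Section dense_times.
Context (R : realType).

(** An enumeration of the positive rationals, with repetitions. *)
Definition rat_time (k : nat) : R :=
  if (unpickle k : option (nat * nat)) is Some (i, j) then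
    i.+1%:R / j.+1%:R else 1.

Lemma rat_time_gt0 k : 0 < rat_time k.
Proof. by rewrite /rat_time; case: unpickle => [[i j]|]//; rewrite divr_gt0. Qed.

Lemma rat_time_approx (t : R) (n : nat) : 0 < t ->
  exists k, t <= rat_time k <= t + n.+1%:R^-1.
Proof.
move=> t0; pose i := Num.truncn (t * n.+1%:R).
exists (pickle (i, n)); rewrite /rat_time pickleK.
have /andP[il iu] := truncn_itv (mulr_ge0 (ltW t0) (ler0n R n.+1)).
have n0 : 0 < n.+1%:R :> R by [].
apply/andP; split; first by rewrite ler_pdivlMr// ltW.
by rewrite ler_pdivrMr// mulrDl mulVf ?gt_eqF// -natr1 lerD2r.
Qed.

End dense_times.

Section maximal.
Context (R : realType) (d : nat).
Local Notation mu := (lebesgue_euclidean R d).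
Implicit Types (f h : euclidean R d -> R) (t L s p C : R) (x y : euclidean R d).

Lemma heat_maximal_ge0 f x : (0 <= heat_maximal f x)%E.
Proof.
apply: (@le_trans _ _ `|heat_semigroup 1 f x|%:E); first by rewrite lee_fin.
by apply: ereal_sup_ubound; exists 1 => //=.
Qed.

Lemma heat_semigroup_le_norm t f x : measurable_fun setT f ->
  (heat_integral t (fun y => `|f y|%R) x < +oo)%E ->
  `|heat_semigroup t f x| <= heat_semigroup t (fun y => `|f y|) x.
Proof.
move=> mf foo; rewrite /heat_semigroup normrM ger0_norm ?invr_ge0 ?powR_ge0//.
rewrite ler_wpM2l ?invr_ge0 ?powR_ge0//.
have -> : (fun y => expR (- sqr_norm y / (4 * t)) * `|f (sub_euclidean x y)|) =
    (fun y => `|expR (- sqr_norm y / (4 * t)) * f (sub_euclidean x y)|).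
  by apply/funext => y; rewrite normrM (ger0_norm (expR_ge0 _)).
apply: le_normr_Rintegral => //; apply/integrableP; split.
  by apply/measurable_EFinP; exact: measurable_heat_integrand.
apply: le_lt_trans foo; apply: le_lower_integral => y //=.
by rewrite lee_fin normrM (ger0_norm (expR_ge0 _)).
Qed.

(** The damping factor is the one that a Gaussian of parameter [n + 1] suffers in
    the extra variable; it increases to [1] with [n].  Restricting the supremum
    to countably many times makes it measurable. *)
Definition damped_maximal (n : nat) h y : \bar R :=
  ereal_sup (range (fun k => (Num.sqrt (n.+1%:R / (rat_time R k + n.+1%:R)) *
     heat_semigroup (rat_time R k) h y)%:E)).

Lemma damped_maximal_ge0 n h y : (forall y, 0 <= h y) ->
  (0 <= damped_maximal n h y)%E.
Proof.
move=> h0; apply: (@le_trans _ _ (Num.sqrt (n.+1%:R / (rat_time R 0 + n.+1%:R)) *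
     heat_semigroup (rat_time R 0) h y)%:E).
  by rewrite lee_fin mulr_ge0 ?heat_semigroup_ge0.
by apply: ereal_sup_ubound; exists 0%N.
Qed.

Lemma measurable_damped_maximal n h : measurable_fun setT h ->
  (forall y, 0 <= h y) ->
  (forall t y, 0 < t -> (heat_integral t h y < +oo)%E) ->
  measurable_fun [set: euclidean R d] (damped_maximal n h).
Proof.
move=> mh h0 hoo.
pose u k y := (Num.sqrt (n.+1%:R / (rat_time R k + n.+1%:R)) *
     heat_semigroup (rat_time R k) h y)%:E.
have -> : damped_maximal n h = fun y => esups (u ^~ y) 0%N.
  apply/funext => y; rewrite /damped_maximal /esups/= /sdrop; congr ereal_sup.
  by apply/seteqP; split => _ [k _ <-]; exists k.
apply: measurable_fun_esups => k.
have -> : u k = (fun y => (Num.sqrt (n.+1%:R / (rat_time R k + n.+1%:R)) *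
   ((4 * pi * rat_time R k) `^ (d%:R / 2))^-1)%:E * heat_integral (rat_time R k) h y)%E.
  apply/funext => y; rewrite /u EFinM heat_semigroupE//; last exact/hoo/rat_time_gt0.
  by rewrite muleA -EFinM.
apply: emeasurable_funM => //; exact: measurable_heat_integral.
Qed.

Lemma damped_maximal_mono m n h y : (forall y, 0 <= h y) -> (m <= n)%N ->
  (damped_maximal m h y <= damped_maximal n h y)%E.
Proof.
move=> h0 mn; apply: ge_ereal_sup => _ [k _ <-].
apply: (@le_trans _ _ (Num.sqrt (n.+1%:R / (rat_time R k + n.+1%:R)) *
     heat_semigroup (rat_time R k) h y)%:E); last first.
  by apply: ereal_sup_ubound; exists k.
rewrite lee_fin ler_wpM2r ?heat_semigroup_ge0// ler_wsqrtr//.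
have q0 := rat_time_gt0 R k.
have mn' : m.+1%:R <= n.+1%:R :> R by rewrite ler_nat.
have m0 : 0 < m.+1%:R :> R by [].
have n0 : 0 < n.+1%:R :> R by [].
rewrite ler_pdivrMr ?addr_gt0// mulrAC ler_pdivlMr ?addr_gt0//; nra.
Qed.

Lemma cvg_damping (K : R) (N : nat) :
  ((1 + K * n.+1%:R^-1) ^+ N)^-1 @[n --> \oo] --> (1 : R).
Proof.
rewrite [X in _ --> X](_ : 1 = ((1 + K * 0) ^+ N)^-1); last first.
  by rewrite mulr0 addr0 expr1n invr1.
apply: cvgV; first by rewrite mulr0 addr0 expr1n oner_neq0.
have cK : 1 + K * n.+1%:R^-1 @[n --> \oo] --> (1 + K * 0 : R).
  apply: cvgD; first exact: cvg_cst.
  by apply: cvgM; [exact: cvg_cst|exact: cvg_harmonic].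
exact: (cvg_comp _ (fun x : R => x ^+ N) cK (@exprn_continuous _ N _)).
Qed.

(** Given [t], take a rational time [q] in [[t, t + 1/(n+1)]].  Both the damping
    factor and the factor lost in replacing [t] by [q] are then at least a fixed
    power of [(1 + K / (n + 1))^-1], which tends to [1]. *)
Lemma heat_semigroup_le_damped t h y : 0 < t -> (forall y, 0 <= h y) ->
  (forall t, 0 < t -> (heat_integral t h y < +oo)%E) ->
  ((heat_semigroup t h y)%:E <= ereal_sup (range (fun n => damped_maximal n h y)))%E.
Proof.
move=> t0 h0 hoo; set B := ereal_sup _.
(* K >= t + 1 >= q serves for the damping factor, K >= 1 / t for t / q. *)
pose K := t + 1 + t^-1.
have K0 : 0 < K by rewrite !addr_gt0 ?invr_gt0.
have key n : ((heat_semigroup t h y * ((1 + K * n.+1%:R^-1) ^+ d.+1)^-1)%:E <= B)%E.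
  have [k /andP[tq qt]] := @rat_time_approx R t n t0.
  apply: (@le_trans _ _ (damped_maximal n h y)); last first.
    by apply: ereal_sup_ubound; exists n.
  apply: (@le_trans _ _ (Num.sqrt (n.+1%:R / (rat_time R k + n.+1%:R)) *
     heat_semigroup (rat_time R k) h y)%:E); last first.
    by apply: ereal_sup_ubound; exists k.
  have q0 := rat_time_gt0 R k; set q := rat_time R k in tq qt q0 *.
  rewrite lee_fin.
  apply: (@le_trans _ _ (Num.sqrt (n.+1%:R / (q + n.+1%:R)) *
     ((t / q) `^ (d%:R / 2) * heat_semigroup t h y))); last first.
    by rewrite ler_wpM2l ?sqrtr_ge0// heat_semigroup_mono// hoo.
  rewrite mulrA mulrC ler_wpM2r ?heat_semigroup_ge0//.
  set e : R := n.+1%:R^-1.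
  have n0 : 0 < n.+1%:R :> R by [].
  have e0 : 0 < e by rewrite invr_gt0.
  have e1 : e <= 1 by rewrite invf_le1// ler1n.
  have ti0 : 0 < t^-1 by rewrite invr_gt0.
  have tti : t * t^-1 = 1 by rewrite divff// gt_eqF.
  set b := 1 + K * e.
  have b1 : 1 <= b by rewrite lerDl mulr_ge0// ltW.
  have b0 : 0 < b by exact: lt_le_trans b1.
  have bV1 : b^-1 <= 1 by rewrite invf_le1.
  have bV0 : 0 < b^-1 by rewrite invr_gt0.
  have h1 : b^-1 <= n.+1%:R / (q + n.+1%:R).
    have -> : n.+1%:R / (q + n.+1%:R) = (1 + q * e)^-1.
      by rewrite /e; field; rewrite nat1r !gt_eqF ?addr_gt0.
    rewrite lef_pV2 ?posrE ?addr_gt0 ?mulr_gt0// lerD2l ler_wpM2r ?(ltW e0)//.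
    by rewrite (le_trans qt)// /K -/e; lra.
  have h2 : b^-1 <= t / q.
    have -> : t / q = (q / t)^-1 by rewrite invf_div.
    rewrite lef_pV2 ?posrE ?divr_gt0//.
    rewrite ler_pdivrMr// (le_trans qt)// -/e /b /K; nra.
  have sq (a : R) : 0 <= a -> a <= 1 -> a <= Num.sqrt a.
    move=> a0 a1; rewrite -[leLHS]ger0_norm// -sqrtr_sqr ler_wsqrtr//.
    by rewrite expr2 ler_piMl.
  rewrite exprS invfM; apply: ler_pM.
  - exact: ltW.
  - by rewrite invr_ge0 exprn_ge0// ltW.
  - apply: (le_trans (sq _ (ltW bV0) bV1)); exact: ler_wsqrtr.
  - rewrite -exprVn -powR_mulrn ?(ltW bV0)//.
    apply: (@le_trans _ _ (b^-1 `^ (d%:R / 2))).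
      apply: ger_powR; rewrite ?bV0//.
      by have d0 : 0 <= d%:R :> R by []; lra.
    apply: ge0_ler_powR => //; rewrite ?nnegrE ?(ltW bV0)//.
    by rewrite divr_ge0// ltW.
have cv : heat_semigroup t h y * ((1 + K * n.+1%:R^-1) ^+ d.+1)^-1 @[n --> \oo]
    --> heat_semigroup t h y.
  by rewrite -[X in _ --> X]mulr1; apply: cvgM; [exact: cvg_cst|exact: cvg_damping].
case: B key => [b| |] keyb.
- rewrite lee_fin; apply: (cvgr_to_le cv); apply: nearW => n.
  by have := keyb n; rewrite lee_fin.
- by rewrite leey.
- by have := keyb 0%N.
Qed.

End maximal.

(** * Monotonicity in the dimension *)

(** The set whose infimum is the best constant, for nonnegative [C]. *)
Definition admissible (R : realType) (d : nat) (p C : R) : Prop :=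
  forall f, f \in Lfun (lebesgue_euclidean R d) p%:E ->
    ('N[lebesgue_euclidean R d]_(p%:E)[heat_maximal f] <=
     C%:E * 'N[lebesgue_euclidean R d]_(p%:E)[EFin \o f])%E.

Section dimension.
Context (R : realType) (d : nat).
Local Notation mu := (lebesgue_euclidean R d).
Local Notation mu1 := (lebesgue_euclidean R d.+1).

(** Apply the inequality in dimension [d + 1] to the product of [h] with a
    Gaussian [g] in the extra variable.  Since the heat flow widens [g], its
    maximal function is at least [g] times the damped maximal function of [h];
    the finite positive factor [a], the integral of [g^p], then cancels. *)
Lemma damped_maximal_bound (p C : R) (h : euclidean R d -> R) (n : nat) :
  1 <= p -> 0 <= C -> admissible d.+1 p C ->
  (forall y, 0 <= h y) -> h \in Lfun mu p%:E ->
  (\int[mu]_y (damped_maximal n h y `^ p) <=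
   (C `^ p)%:E * \int[mu]_y (h y `^ p)%:E)%E.
Proof.
move=> p1 C0 adm h0 hL; have p0 : 0 < p by exact: lt_le_trans p1.
have [mh Ih] := (mem_LfunP mu h p0).1 hL.
have hE y : `|h y| = h y by rewrite ger0_norm.
have hoo t y : 0 < t -> (heat_integral t h y < +oo)%E.
  move=> t0; have := heat_integral_lty y p1 t0 hL.
  by rewrite (_ : (fun y => `|h y|) = h)//; apply/funext.
have Ih' : (\int[mu]_y (h y `^ p)%:E < +oo)%E.
  by under eq_integral do rewrite -hE.
pose L : R := n.+1%:R; have L0 : 0 < L by [].
pose g := gauss_line L; pose F := tensor *%R g h.
have mg : measurable_fun [set: R] g by exact: measurable_gauss_line.
have g0 s : 0 <= g s by exact: gauss_line_ge0.
have F0 x : 0 <= F x by rewrite mulr_ge0.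
have mpg : measurable_fun [set: R] (fun s => (g s `^ p)%:E).
  apply/measurable_EFinP.
  exact: (@measurableT_comp _ _ _ _ _ _ (@powR R ^~ p)).
have mph : measurable_fun [set: euclidean R d] (fun y => (h y `^ p)%:E).
  apply/measurable_EFinP.
  exact: (@measurableT_comp _ _ _ _ _ _ (@powR R ^~ p)).
pose a := Num.sqrt (4 * pi * (L / p)).
have a0 : 0 < a by rewrite sqrtr_gt0 !mulr_gt0 ?pi_gt0// invr_gt0.
have IF : (\int[mu1]_x (`|F x| `^ p)%:E = a%:E * \int[mu]_y (h y `^ p)%:E)%E.
  rewrite -(@integral_gauss_lineX _ p L)// -integral_tensor//.
  - apply: eq_integral => x _; rewrite /tensor -EFinM ger0_norm// /F /tensor.
    by rewrite powRM.
  - by move=> s; rewrite lee_fin powR_ge0.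
  - by move=> y; rewrite lee_fin powR_ge0.
have FL : F \in Lfun mu1 p%:E.
  apply/mem_LfunP => //; split; first exact: measurable_tensor.
  by rewrite IF lte_mul_pinfty// lee_fin ltW.
have := adm _ FL; rewrite le_Lnorm_integral//.
rewrite (_ : (\int[mu1]_x `|(EFin \o F) x| `^ p = \int[mu1]_x (`|F x| `^ p)%:E)%E); last first.
  exact: eq_integral.
rewrite IF muleCA => adm'.
rewrite -(@lee_pmul2l _ a%:E)//.
apply: le_trans adm'.
have M0 y := damped_maximal_ge0 n y h0.
have mM := @measurable_damped_maximal R d n h mh h0 hoo.
rewrite -(@integral_gauss_lineX _ p L)// -integral_tensor//; last 3 first.
- exact: (@measurableT_comp _ _ _ _ _ _ (@poweR R ^~ p) _ _ (measurable_poweR p)).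
- by move=> s; rewrite lee_fin powR_ge0.
- by move=> y; exact: poweR_ge0.
apply: le_lower_integral => x.
  by rewrite /tensor mule_ge0 ?lee_fin ?powR_ge0 ?poweR_ge0.
have -> : x = cons_pair (thead x, [tuple of behead x]) by exact: tuple_eta.
set s := thead x; set y := [tuple of _]; rewrite tensorE.
rewrite gee0_abs ?heat_maximal_ge0// -poweR_EFin -poweRM ?lee_fin//.
apply: gt0_ler_poweR; rewrite ?in_itv/= ?leey ?andbT ?heat_maximal_ge0
  ?mule_ge0 ?lee_fin ?gauss_line_ge0 ?(ltW p0)//.
rewrite /damped_maximal -ereal_sup_pZl; last exact: expR_gt0.
apply: ge_ereal_sup => _ [_ [k _ <-] <-].
have q0 := rat_time_gt0 R k; set q := rat_time R k in q0 *.
apply: (@le_trans _ _ `|heat_semigroup q F (cons_pair (s, y))|%:E); last first.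
  by apply: ereal_sup_ubound; exists q.
rewrite /F heat_semigroup_tensor ?hoo// ger0_norm; last first.
  apply: mulr_ge0; last exact: heat_semigroup_ge0.
  by rewrite mulr_ge0 ?sqrtr_ge0 ?gauss_line_ge0.
rewrite -EFinM lee_fin mulrCA mulrA ler_wpM2r ?heat_semigroup_ge0//.
rewrite ler_wpM2l ?sqrtr_ge0// gauss_line_le//; exact: ltW.
Qed.

(** Replacing [f] by [|f|] does not change its norm and can only increase its
    maximal function; then let the Gaussian widen in the previous bound. *)
Lemma admissible_lower_dimension (p C : R) : 1 <= p -> 0 <= C ->
  admissible d.+1 p C -> admissible d p C.
Proof.
move=> p1 C0 adm f fL; have p0 : 0 < p by exact: lt_le_trans p1.
have [mf If] := (mem_LfunP mu f p0).1 fL.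
pose h y := `|f y|.
have h0 y : 0 <= h y by rewrite /h.
have mh : measurable_fun [set: euclidean R d] h by exact: measurableT_comp.
have hL : h \in Lfun mu p%:E.
  apply/(mem_LfunP _ _ p0); split; first exact: mh.
  by under eq_integral do rewrite normr_id.
have hoo t y : 0 < t -> (heat_integral t h y < +oo)%E.
  by move=> t0; exact: heat_integral_lty p1 t0 fL.
rewrite le_Lnorm_integral//.
rewrite (_ : (\int[mu]_x `|(EFin \o f) x| `^ p = \int[mu]_x (h x `^ p)%:E)%E); last first.
  exact: eq_integral.
pose W n y := (damped_maximal n h y `^ p)%E.
have W0 n y : (0 <= W n y)%E by exact: poweR_ge0.
have mW n : measurable_fun [set: euclidean R d] (W n).
  apply: (@measurableT_comp _ _ _ _ _ _ (@poweR R ^~ p) _ _ (measurable_poweR p)).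
  exact: measurable_damped_maximal.
have ndW y : {homo W^~ y : n m / (n <= m)%N >-> (n <= m)%E}.
  move=> m n mn; apply: gt0_ler_poweR; rewrite ?in_itv/= ?leey ?damped_maximal_ge0 ?(ltW p0)//.
  exact: damped_maximal_mono.
apply: (@le_trans _ _ (\int[mu]_y limn (W ^~ y))%E).
  apply: le_lower_integral => y; first exact: poweR_ge0.
  have limW n : (W n y <= limn (W ^~ y))%E.
    rewrite (cvg_lim _ (ereal_nondecreasing_cvgn (@ndW y)))//.
    by apply: ereal_sup_ubound; exists n.
  rewrite gee0_abs ?heat_maximal_ge0//.
  apply: (@le_trans _ _ ((ereal_sup (range (fun n => damped_maximal n h y))) `^ p)%E).
    apply: gt0_ler_poweR; rewrite ?in_itv/= ?leey ?heat_maximal_ge0 ?(ltW p0)//.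
      rewrite andbT; apply: le_trans (damped_maximal_ge0 0 y h0) _.
      by apply: ereal_sup_ubound; exists 0%N.
    apply: ge_ereal_sup => _ [t /= t0 <-].
    apply: le_trans (heat_semigroup_le_damped t0 h0 (fun t => @hoo t y)).
    rewrite lee_fin; apply: heat_semigroup_le_norm => //; exact: hoo.
  apply: poweR_ereal_sup_le => //.
  - by move=> _ [n _ <-]; exact: damped_maximal_ge0.
  - by exists (damped_maximal 0 h y), 0%N.
  - move=> _ [n _ <-]; exact: limW.
rewrite monotone_convergence//; apply: lime_le.
  apply: ereal_nondecreasing_is_cvgn => m n mn.
  by apply: le_lower_integral => // y; exact: ndW.
by apply: nearW => n; exact: damped_maximal_bound.
Qed.

End dimension.

Lemma heat_maximal_norm_nondecreasing (R : realType) (d : nat) (p : R) : 1 <= p ->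
  (heat_maximal_norm d p <= heat_maximal_norm d.+1 p)%E.
Proof.
move=> p1; apply: ereal_inf_le_tmp => _ [C [C0 adm] <-]; exists C => //; split => //.
exact: admissible_lower_dimension.
Qed.

(** An admissible [C] gives [K |f|_p <= C |f|_p], and the norm of [f], finite and
    nonzero, cancels. *)
Lemma heat_maximal_norm_ge (R : realType) (d : nat) (p K : R) (f : euclidean R d -> R) :
  0 < p -> 0 <= K -> f \in Lfun (lebesgue_euclidean R d) p%:E ->
  ('N[lebesgue_euclidean R d]_p%:E[EFin \o f] != 0)%E ->
  (forall x, ((K * `|f x|)%:E <= heat_maximal f x)%E) ->
  (K%:E <= heat_maximal_norm d p)%E.
Proof.
move=> p0 K0 fL f0 Kf; apply: le_ereal_inf_tmp => _ [C [C0 adm] <-].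
set N := ('N[_]_p%:E[EFin \o f])%E in f0 *.
have N0 : (0 < N)%E by rewrite lt0e f0 Lnorm_ge0.
have Noo : N \is a fin_num.
  rewrite ge0_fin_numE ?Lnorm_ge0//.
  by have := sub_Lfun_finLfun fL; rewrite inE.
rewrite -(@lee_pmul2r _ N)//; apply: le_trans (adm _ fL).
have pn0 : p != 0 by rewrite gt_eqF.
have KN0 : (0 <= K%:E * N)%E by rewrite mule_ge0 ?lee_fin ?Lnorm_ge0.
rewrite -(poweRK p0 KN0) -(poweRK p0 (Lnorm_ge0 _ _ _)).
apply: gt0_ler_poweR; rewrite ?in_itv/= ?leey ?poweR_ge0 ?invr_ge0 ?(ltW p0)//.
rewrite poweRM ?lee_fin ?Lnorm_ge0// !poweR_Lnorm// poweR_EFin.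
rewrite -ge0_integralZl_EFin ?powR_ge0//; last 2 first.
- by move=> x _; exact: poweR_ge0.
- apply: (@measurableT_comp _ _ _ _ _ _ (@poweR R ^~ p) _ _ (measurable_poweR p)).
  apply: measurableT_comp => //; apply/measurable_EFinP.
  by case/(mem_LfunP _ _ p0) : fL.
apply: le_lower_integral => x; first by rewrite mule_ge0 ?lee_fin ?powR_ge0 ?poweR_ge0.
rewrite -poweR_EFin -poweRM ?lee_fin ?abse_ge0//.
apply: gt0_ler_poweR; rewrite ?in_itv/= ?leey ?andbT ?mule_ge0 ?(ltW p0)//.
by rewrite gee0_abs ?heat_maximal_ge0//; exact: Kf.
Qed.

(** On a point the semigroup is the identity. *)
Lemma heat_maximal_norm0_ge1 (R : realType) (p : R) : 0 < p ->
  (1 <= heat_maximal_norm 0 p)%E.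
Proof.
move=> p0.
have one1 : (fun x : euclidean R 0 => `|(cst 1 x : R)|) = cst 1.
  by apply/funext => x; rewrite normr1.
apply: (@heat_maximal_norm_ge _ _ _ 1 (cst 1)) => //.
- apply/mem_LfunP => //; split; first exact: measurable_cst.
  rewrite integral_dirac//= normr1 powR1 mule1; exact: ltry.
- rewrite (_ : EFin \o _ = cst 1%E)// Lnorm_cst1.
  rewrite [X in (X `^ _)%E](_ : _ = 1%E); last exact: diracT.
  by rewrite poweR1r onee_neq0.
- move=> x; rewrite /= normr1 mulr1.
  apply: (@le_trans _ _ `|heat_semigroup 1 (cst 1) x|%:E); last first.
    by apply: ereal_sup_ubound; exists 1 => //=.
  rewrite lee_fin /heat_semigroup mul0r powRr0 invr1 mul1r.
  rewrite /Rintegral /= integral_dirac//=.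
    by rewrite indicT mul1r /sqr_norm big_ord0 oppr0 mul0r expR0 mulr1 normr1.
  apply/measurable_EFinP; exact: (@measurable_heat_integrand R 0 1 (cst 1) x).
Qed.

(** * Real-variable estimates *)

Section real_bounds.
Context (R : realType).
Implicit Types u w x y : R.

Lemma expRDN_ge2 w : 2 <= expR w + expR (- w).
Proof.
have E1 : expR w * expR (- w) = 1 by rewrite -expRD subrr expR0.
have := sqr_ge0 (expR w - expR (- w)); have := expR_gt0 w; have := expR_gt0 (- w).
nra.
Qed.

(** Mean value theorem at [0]: the derivative is [expR x + expR (- x) >= 2]. *)
Lemma sinh_ge w : 0 <= w -> 2 * w <= expR w - expR (- w).
Proof.
move=> w0; pose S x := expR x - expR (- x).
have dS x : x \in `]0, w[ -> is_derive x 1 S (expR x + expR (- x)).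
  move=> _; rewrite /S; apply: is_derive_eq.
  by rewrite mulrN1 opprK.
have [|c _] := MVT_segment w0 dS.
  apply: derivable_within_continuous => x _.
  by rewrite /S; exact: ex_derive.
rewrite {1 2}/S subr0 oppr0 subrr subr0 => ->.
by rewrite ler_wpM2r// expRDN_ge2.
Qed.

(** The difference [expR u + expR (- u) - 2] is the square of
    [expR (u / 2) - expR (- (u / 2))], which is at least [u]. *)
Lemma cosh_ge u : 0 <= u -> 2 + u ^+ 2 <= expR u + expR (- u).
Proof.
move=> u0; have := @sinh_ge (u / 2) (divr_ge0 u0 (ler0n _ 2)).
have E1 : expR (u / 2) * expR (- (u / 2)) = 1 by rewrite -expRD subrr expR0.
have -> : expR u = expR (u / 2) ^+ 2 by rewrite expr2 -expRD -splitr.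
have -> : expR (- u) = expR (- (u / 2)) ^+ 2.
  by rewrite expr2 -expRD -opprD -splitr.
nra.
Qed.

(** With [v = u^2 / 2] the right-hand side is
    [e^(-1) e^(1/2 - v) (e^u + e^(-u)) >= e^(-1) (3/2 - v) (2 + 2 v)], and this
    last product is at least [3 / e] for [0 <= v <= 1/2]. *)
Lemma gauss_pair_ge u : 0 <= u -> u <= 1 ->
  3 * expR (- 1) <= expR (- (1 - u) ^+ 2 / 2) + expR (- (1 + u) ^+ 2 / 2).
Proof.
move=> u0 u1; pose v := u ^+ 2 / 2.
have -> : - (1 - u) ^+ 2 / 2 = - 1 + (2^-1 - v) + u by rewrite /v; field.
have -> : - (1 + u) ^+ 2 / 2 = - 1 + (2^-1 - v) - u by rewrite /v; field.
rewrite !expRD -mulrDr mulrC -mulrA ler_wpM2l ?expR_ge0//.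
have v0 : 0 <= v by rewrite divr_ge0 ?sqr_ge0.
have v1 : v <= 2^-1.
  by rewrite /v ler_pdivrMr// mulVf// expr_le1.
have h1 : 1 + (2^-1 - v) <= expR (2^-1 - v) by exact: expR_ge1Dx.
have h2 := cosh_ge u0.
apply: (@le_trans _ _ ((1 + (2^-1 - v)) * (2 + 2 * v))); first by nra.
apply: ler_pM; [lra|lra|by rewrite -expRD|].
by apply: le_trans h2; rewrite /v; lra.
Qed.

(** The quarter of [pi] is [atan 1]; the derivative of [atan] is at most [1] on
    [[0, 1/2]] and at most [4/5] on [[1/2, 1]], so [pi / 4 <= 1/2 + 2/5]. *)
Lemma pi_le : pi <= 36 / 10 :> R.
Proof.
have mvt (a b : R) : 0 <= a -> a <= b ->
    atan b - atan a <= (1 + a ^+ 2)^-1 * (b - a).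
  move=> a0 ab.
  have [|c] := @MVT_segment R atan (fun x => (1 + x ^+ 2)^-1) a b ab.
  - by apply: derivable_within_continuous => x _; exact: derivable_atan.
  rewrite in_itv/= => /andP[ac cb] ->.
  rewrite ler_wpM2r ?subr_ge0// lef_pV2 ?posrE ?ltr_wpDr ?sqr_ge0//.
  by rewrite lerD2l ler_sqr ?nnegrE// (le_trans a0).
have h1 : atan 2^-1 - atan 0 <= 2^-1 :> R.
  have := mvt 0 2^-1 (lexx _); rewrite expr0n/= addr0 invr1 mul1r subr0; apply; lra.
have h2 : atan 1 - atan 2^-1 <= 2 / 5 :> R.
  apply: le_trans (mvt _ _ _ _) _; [lra|lra|].
  rewrite (_ : 1 + 2^-1 ^+ 2 = 5 / 4 :> R); last by field.
  by rewrite invf_div; lra.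
by have := atan1 R; have := atan0 R; lra.
Qed.

(** Start from [1 - 1/32 <= expR (- 1/32)] and square five times, rounding down. *)
Lemma expRN1_ge : 36 / 100 <= expR (- 1) :> R.
Proof.
have h0 : 31 / 32 <= expR (- 32^-1) :> R.
  by have := expR_ge1Dx (- 32^-1 : R); lra.
have dbl (a b x y : R) : 0 <= a -> b <= a ^+ 2 -> y = x + x ->
    a <= expR x -> b <= expR y.
  by move=> a0 ba -> ax; rewrite expRD (le_trans ba)// expr2 ler_pM.
have h1 : 61 / 65 <= expR (- 16^-1) :> R.
  apply: (dbl _ _ _ _ _ _ _ h0); lra.
have h2 : 59 / 67 <= expR (- 8^-1) :> R.
  apply: (dbl _ _ _ _ _ _ _ h1); lra.
have h3 : 31 / 40 <= expR (- 4^-1) :> R.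
  apply: (dbl _ _ _ _ _ _ _ h2); lra.
have h4 : 3 / 5 <= expR (- 2^-1) :> R.
  apply: (dbl _ _ _ _ _ _ _ h3); lra.
apply: (dbl _ _ _ _ _ _ _ h4); lra.
Qed.

Definition heat_const : R := 3 * expR (- 1) / Num.sqrt (2 * pi).

Lemma heat_const_gt : 4 / 10 < heat_const.
Proof.
have p0 : 0 < 2 * pi :> R by rewrite mulr_gt0 ?pi_gt0.
rewrite /heat_const ltr_pdivlMr ?sqrtr_gt0//.
(* 2.69 ^ 2 > 7.2 >= 2 pi, and 3 * 0.36 > 0.4 * 2.69. *)
have : Num.sqrt (2 * pi) <= 269 / 100 :> R.
  rewrite -[leRHS]ger0_norm; last lra.
  by rewrite -sqrtr_sqr ler_wsqrtr//; have := pi_le; lra.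
by have := expRN1_ge; lra.
Qed.

Lemma heat_const_le1 : heat_const <= 1.
Proof.
have p0 : 0 < 2 * pi :> R by rewrite mulr_gt0 ?pi_gt0.
rewrite /heat_const ler_pdivrMr ?sqrtr_gt0// mul1r.
have : 2 <= Num.sqrt (2 * pi) :> R.
  rewrite -[leLHS]ger0_norm; last lra.
  by rewrite -sqrtr_sqr ler_wsqrtr//; have := pihalf_ge1 R; lra.
have : expR (- 1) * 2 <= 1 :> R.
  rewrite expRN mulrC ler_pdivrMr ?expR_gt0// mul1r.
  by have := expR_ge1Dx (1 : R); lra.
lra.
Qed.

(** The fundamental theorem of calculus on [[x / (n + 2), x]], away from the
    singularity, then monotone convergence. *)
Lemma integral_power (b x : R) : b < 1 -> 0 < x ->
  (\int[lebesgue_measure]_(y in `[0%R, x]) (y `^ (- b))%:E =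
   (x `^ (1 - b) / (1 - b))%:E)%E.
Proof.
move=> b1 x0; have c0 : 0 < 1 - b by rewrite subr_gt0.
have mf D : measurable_fun D (fun y : R => (y `^ (- b))%:E).
  apply/measurable_EFinP; apply: measurable_funTS; exact: measurable_powR.
rewrite -integral_itv_obnd_cbnd//.
pose e n : R := x / n.+2%:R.
have e0 n : 0 < e n by rewrite divr_gt0.
have ex n : e n < x by rewrite ltr_pdivrMr// ltr_pMr// ltr1n.
have FTC n : (\int[lebesgue_measure]_(y in `[e n, x]) (y `^ (- b))%:E =
    (x `^ (1 - b) / (1 - b) - e n `^ (1 - b) / (1 - b))%:E)%E.
  pose F y : R := y `^ (1 - b) / (1 - b).
  have dF y : 0 < y -> is_derive y 1 F (y `^ (- b)).
    move=> y0; have D := is_derive1_powR (1 - b) y0.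
    have -> : F = (1 - b)^-1 *: (@powR R ^~ (1 - b)).
      by apply/funext => z; rewrite /F mulrC.
    apply: is_derive_eq.
    rewrite /GRing.scale/= mulrA mulVf ?gt_eqF// mul1r; congr (_ `^ _); lra.
  have cF y : 0 < y -> F z @[z --> y] --> F y.
    move=> y0; apply: differentiable_continuous; apply/derivable1_diffP.
    by have := dF y y0; case.
  rewrite EFinB; apply: (@continuous_FTC2 _ _ F) => //.
  - apply: derivable_within_continuous => y; rewrite in_itv/= => /andP[ey _].
    apply: derivable_powR; rewrite in_itv/= andbT; exact: lt_le_trans ey.
  - split.
    + move=> y; rewrite in_itv/= => /andP[ey _].
      by have := dF y (lt_trans (e0 n) ey); case.
    + exact/cvg_at_right_filter/cF.
    + exact/cvg_at_left_filter/cF.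
  - move=> y; rewrite in_itv/= => /andP[ey _].
    by have dy := dF y (lt_trans (e0 n) ey); rewrite derive1E derive_val.
have U : `]0, x]%classic = \bigcup_n `[e n, x]%classic.
  apply/seteqP; split => y /=.
    rewrite in_itv/= => /andP[y0 yx]; exists (Num.truncn (x / y)) => //=.
    rewrite in_itv/= yx andbT /e ler_pdivrMr// mulrC -ler_pdivrMr//.
    have /andP[_ h] := truncn_itv (ltW (divr_gt0 x0 y0)).
    by rewrite (le_trans (ltW h))// ler_nat.
  move=> [n _]/=; rewrite !in_itv/= => /andP[ey ->].
  by rewrite andbT (lt_le_trans (e0 n)).
have cv : (\int[lebesgue_measure]_(y in `[e n, x]) (y `^ (- b))%:E)%E @[n --> \oo]
    --> (\int[lebesgue_measure]_(y in \bigcup_n `[e n, x]%classic) (y `^ (- b))%:E)%E.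
  apply: ge0_nondecreasing_set_cvg_integral => //.
  - move=> m n mn; rewrite subsetEset => y /=; rewrite !in_itv/= => /andP[ey ->].
    rewrite andbT (le_trans _ ey)// ler_wpM2l ?(ltW x0)//.
    by rewrite lef_pV2 ?posrE// ler_nat.
  - move=> n; exact: mf.
  - by move=> n y _; rewrite lee_fin powR_ge0.
rewrite U -(cvg_lim _ cv)//; apply/cvg_lim => //.
rewrite (eq_cvg _ _ FTC); apply: cvg_EFin; first exact: nearW.
rewrite -[X in _ --> X]subr0.
apply: cvgB; first exact: cvg_cst.
rewrite -[X in _ --> X](mul0r (1 - b)^-1); apply: cvgM; last exact: cvg_cst.
have /cvg_at_rightP := powR_cvg0 c0; apply; split => //.
rewrite /e -[X in _ --> X](mulr0 x); apply: cvgM; first exact: cvg_cst.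
have := @cvg_harmonic R; rewrite -(cvg_shiftS (@harmonic R)); exact.
Qed.

End real_bounds.

(** * Dimension one: truncated powers *)

Section power_bump.
Context (R : realType).
Local Notation mu := (@lebesgue_measure R).
Implicit Types (a s t v p : R) (x : euclidean R 1).

Lemma integral_euclidean1 (H : R -> \bar R) :
  measurable_fun [set: _] H -> (forall y, 0 <= H y)%E ->
  (\int[lebesgue_euclidean R 1]_x H (thead x) = \int[mu]_y H y)%E.
Proof.
move=> mH H0.
have mHt : measurable_fun [set: euclidean R 1] (fun x => H (thead x)).
  exact: (measurableT_comp mH (@measurable_theadR R 0)).
rewrite integral_cons//.
apply: eq_integral => s _; rewrite [LHS]integral_dirac//; last first.
  exact: (measurableT_comp mHt (measurable_cons_pairr s)).
by rewrite diracT mul1e.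
Qed.

(** Fold the negative half-line onto the positive one; the origin, which is
    counted twice, is a null set. *)
Lemma integral_fold (H : R -> \bar R) :
  measurable_fun [set: _] H -> (forall y, 0 <= H y)%E ->
  (\int[mu]_y H y = \int[mu]_(y in `[0%R, +oo[) (H y + H (- y)%R))%E.
Proof.
move=> mH H0.
have mHN : measurable_fun [set: R] (fun y => H (- y)).
  by apply: (measurableT_comp mH); exact: measurable_funN.
rewrite ge0_integralD//; [|exact: measurable_funTS..].
rewrite (@ge0_integration_by_substitution0 R (fun y => H (- y)))//.
under [X in (_ + X)%E]eq_integral do rewrite opprK.
rewrite -integral_itv_bndo_bndc; last exact: measurable_funTS.
rewrite -ge0_integral_setU//=; last 2 first.
- exact: measurable_funTS.
- by apply/disj_setPLR => y /=; rewrite !in_itv/= andbT => y0; apply/negP; rewrite -leNgt.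
congr (integral _ _ _).
by rewrite setUC (itv_setU_setT true).
Qed.

(** A power with nonzero exponent takes the value [0] at [0]; for [a != 0] the
    bump vanishes there, and a pointwise lower bound by it is trivial. *)
Definition power_bump a v : R := if `|v| <= 1 then `|v| `^ (- a) else 0.

Lemma power_bump_ge0 a v : 0 <= power_bump a v.
Proof. by rewrite /power_bump; case: ifP => // _; exact: powR_ge0. Qed.

Lemma power_bumpN a v : power_bump a (- v) = power_bump a v.
Proof. by rewrite /power_bump normrN. Qed.

Lemma measurable_power_bump a : measurable_fun [set: R] (power_bump a).
Proof.
apply: measurable_fun_ifT => //.
  by apply: measurable_fun_ler => //; exact: measurableT_comp.
exact: (@measurableT_comp _ _ _ _ _ _ (@powR R ^~ (- a))).
Qed.

Lemma integral_power_bumpX a p : 0 < p -> a * p < 1 ->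
  (\int[mu]_v (power_bump a v `^ p)%:E = (2 / (1 - a * p))%:E)%E.
Proof.
move=> p0 ap1.
have mp : measurable_fun [set: R] (fun v => (power_bump a v `^ p)%:E).
  apply/measurable_EFinP.
  apply: (@measurableT_comp _ _ _ _ _ _ (@powR R ^~ p)) => //.
  exact: measurable_power_bump.
rewrite integral_fold//; last by move=> y; rewrite lee_fin powR_ge0.
transitivity (\int[mu]_(v in `[0%R, +oo[)
   ((fun v => 2%:E * (v `^ (- (a * p)))%:E) \_ `[0%R, 1%R] v))%E.
  apply: eq_integral => v; rewrite inE/= in_itv/= andbT => v0.
  rewrite patchE power_bumpN -EFinD /power_bump ger0_norm//.
  case: ifPn => [v1|v1].
    rewrite mem_set; last by rewrite /= in_itv/= v0.
    by rewrite -powRrM mulNr -EFinM mulr_natl mulr2n.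
  rewrite memNset; last by rewrite /= in_itv/= v0; exact/negP.
  by rewrite powR0 ?gt_eqF// addr0.
rewrite -integral_mkcondr.
rewrite (_ : _ `&` _ = `[0%R, 1%R]%classic); last first.
  apply/seteqP; split => v /=; rewrite !in_itv/= ?andbT; first by case.
  by move=> /andP[v0 v1]; rewrite v0.
rewrite ge0_integralZl_EFin//.
- by rewrite integral_power// powR1 -EFinM div1r.
- by move=> v _; rewrite lee_fin powR_ge0.
- by apply/measurable_EFinP; apply: measurable_funTS; exact: measurable_powR.
Qed.

Definition radial_power a x : R := power_bump a (thead x).

Lemma measurable_radial_power a : measurable_fun [set: euclidean R 1] (radial_power a).
Proof.
exact: (measurableT_comp (measurable_power_bump a) (@measurable_theadR R 0)).
Qed.

Lemma integral_radial_powerX a p : 0 < p -> a * p < 1 ->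
  (\int[lebesgue_euclidean R 1]_x (`|radial_power a x| `^ p)%:E =
   (2 / (1 - a * p))%:E)%E.
Proof.
move=> p0 ap; rewrite -integral_power_bumpX//.
under eq_integral do rewrite ger0_norm ?power_bump_ge0//.
rewrite (integral_euclidean1 (H := fun v => (power_bump a v `^ p)%:E))//.
  apply/measurable_EFinP.
  apply: (@measurableT_comp _ _ _ _ _ _ (@powR R ^~ p)) => //.
  exact: measurable_power_bump.
by move=> y; rewrite lee_fin powR_ge0.
Qed.

Lemma radial_power_Lfun a p : 0 < p -> a * p < 1 ->
  radial_power a \in Lfun (lebesgue_euclidean R 1) p%:E.
Proof.
move=> p0 ap; apply/mem_LfunP => //; split; first exact: measurable_radial_power.
by rewrite integral_radial_powerX// ltry.
Qed.

(** Convolution is commutative: the substitution [v = thead x - u] leaves [g]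
    itself, whose singularity is at the origin, under the integral. *)
Lemma heat_integral_line t (g : R -> R) x : measurable_fun setT g ->
  (forall v, 0 <= g v) ->
  (heat_integral t (fun y : euclidean R 1 => g (thead y)) x =
   \int[mu]_v (expR (- (thead x - v) ^+ 2 / (4 * t)) * g v)%:E)%E.
Proof.
move=> mg g0; set s : R := thead x.
pose K v : \bar R := (expR (- (s - v) ^+ 2 / (4 * t)) * g v)%:E.
have mK : measurable_fun [set: R] K.
  apply/measurable_EFinP; apply: measurable_funM => //.
  apply: measurableT_comp => //; apply: measurable_funM => //.
  by apply: measurable_funN; apply: measurable_funX; exact: measurable_funB.
have K0 v : (0 <= K v)%E by rewrite lee_fin mulr_ge0 ?expR_ge0.
rewrite -(integral_reflect s mK K0).
rewrite -(integral_euclidean1 (H := fun u => K (s - u)%R))//; last first.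
  by apply: (measurableT_comp mK); exact: measurable_funB.
apply: eq_integral => y _; rewrite /K /gauss /sqr_norm big_ord1 subKr.
by rewrite [thead (sub_euclidean x y)]tnth_mktuple.
Qed.

(** After folding, keep only [v <= |s|], where the bump is a pure power and
    [gauss_pair_ge] applies to the ratio [u = v / |s|]. *)
Lemma power_bump_gauss_ge a s : a < 1 -> s != 0 -> `|s| <= 1 ->
  ((3 * expR (- 1) * (`|s| `^ (1 - a) / (1 - a)))%:E <=
   \int[mu]_v (expR (- (s - v) ^+ 2 / (2 * s ^+ 2)) * power_bump a v)%:E)%E.
Proof.
move=> a1 s0 s1; pose r := `|s|.
have r0 : 0 < r by rewrite normr_gt0.
have c0 : 0 <= 3 * expR (- 1) :> R by rewrite mulr_ge0 ?expR_ge0.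
pose K v : \bar R := (expR (- (s - v) ^+ 2 / (2 * s ^+ 2)) * power_bump a v)%:E.
have mK : measurable_fun [set: R] K.
  apply/measurable_EFinP; apply: measurable_funM => //; last exact: measurable_power_bump.
  apply: measurableT_comp => //; apply: measurable_funM => //.
  by apply: measurable_funN; apply: measurable_funX; exact: measurable_funB.
have K0 v : (0 <= K v)%E by rewrite lee_fin mulr_ge0 ?expR_ge0 ?power_bump_ge0.
have mKN : measurable_fun [set: R] (fun v => K (- v)).
  by apply: (measurableT_comp mK); exact: measurable_funN.
rewrite (integral_fold mK K0) EFinM -integral_power//.
rewrite -ge0_integralZl_EFin//; last 2 first.
- by move=> v _; rewrite lee_fin powR_ge0.
- by apply/measurable_EFinP; apply: measurable_funTS; exact: measurable_powR.
apply: (@le_trans _ _ (\int[mu]_(v in `[0%R, r]) (K v + K (- v)%R))%E).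
- apply: ge0_le_integral => //.
  + by move=> v _; rewrite -EFinM lee_fin mulr_ge0 ?powR_ge0.
  + apply/measurable_EFinP; apply: measurable_funM => //.
    apply: measurable_funTS; exact: measurable_powR.
  + by apply: measurable_funTS; exact: emeasurable_funD.
  move=> v /=; rewrite in_itv/= => /andP[v0 vr].
  rewrite /K power_bumpN -EFinM -EFinD lee_fin -mulrDl /power_bump ger0_norm//.
  rewrite (le_trans vr s1) ler_wpM2r ?powR_ge0//.
  have u0 : 0 <= v / r by rewrite divr_ge0// ltW.
  have u1 : v / r <= 1 by rewrite ler_pdivrMr// mul1r.
  apply: le_trans (gauss_pair_ge u0 u1) _.
  have [sr|sr] : s = r \/ s = - r.
    by rewrite /r; case: (leP 0 s) => h; [left; rewrite ger0_norm|right; rewrite ltr0_norm ?opprK].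
  - rewrite sr; rewrite -(_ : - (r - v) ^+ 2 / (2 * r ^+ 2) = - (1 - v / r) ^+ 2 / 2).
      rewrite -(_ : - (r - - v) ^+ 2 / (2 * r ^+ 2) = - (1 + v / r) ^+ 2 / 2)//.
      by field; rewrite gt_eqF.
    by field; rewrite gt_eqF.
  - rewrite sr addrC sqrrN.
    rewrite -(_ : - (- r - v) ^+ 2 / (2 * r ^+ 2) = - (1 + v / r) ^+ 2 / 2).
      rewrite -(_ : - (- r - - v) ^+ 2 / (2 * r ^+ 2) = - (1 - v / r) ^+ 2 / 2)//.
      by field; rewrite gt_eqF.
    by field; rewrite gt_eqF.
- apply: ge0_subset_integral => //.
  + by apply: measurable_funTS; exact: emeasurable_funD.
  + by move=> v _; rewrite adde_ge0.
  + by move=> v /=; rewrite !in_itv/= => /andP[->].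
Qed.

(** The time [s^2 / 2] is the one for which the normalised Gaussian at distance
    [|s|] is largest; at this time scaling turns everything into the power of [|s|] that
    the test function has, so the same constant serves at every point. *)
Lemma heat_maximal_radial_power_ge a p x : 1 <= p -> 0 < a -> a * p < 1 ->
  ((heat_const R / (1 - a) * `|radial_power a x|)%:E <=
   heat_maximal (radial_power a) x)%E.
Proof.
move=> p1 a0 ap; have p0 : 0 < p by exact: lt_le_trans p1.
have a1 : a < 1 by rewrite (le_lt_trans _ ap)// ler_peMr// ltW.
have c0 : 0 < 1 - a by rewrite subr_gt0.
rewrite ger0_norm ?power_bump_ge0// /radial_power.
set s : R := thead x.
have [s0|s0] := eqVneq s 0.
  rewrite s0 /power_bump normr0 ler01 powR0 ?oppr_eq0 ?gt_eqF// mulr0.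
  exact: heat_maximal_ge0.
rewrite /power_bump; case: ifPn => [s1|_]; last first.
  by rewrite mulr0; exact: heat_maximal_ge0.
pose r := `|s|; have r0 : 0 < r by rewrite normr_gt0.
have s2 : s ^+ 2 = r ^+ 2 by rewrite /r real_normK ?num_real.
pose t := r ^+ 2 / 2; have t0 : 0 < t by rewrite divr_gt0 ?exprn_gt0.
apply: (@le_trans _ _ `|heat_semigroup t (radial_power a) x|%:E); last first.
  by apply: ereal_sup_ubound; exists t.
have Hoo : (heat_integral t (radial_power a) x < +oo)%E.
  have := heat_integral_lty x p1 t0 (radial_power_Lfun p0 ap).
  rewrite (_ : (fun y => `|radial_power a y|) = radial_power a)//.
  by apply/funext => y; rewrite ger0_norm ?power_bump_ge0.
have f0 y : 0 <= radial_power a y by exact: power_bump_ge0.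
rewrite (ger0_norm (heat_semigroup_ge0 _ _ f0)) heat_semigroupE//.
rewrite heat_integral_line//; last 2 first.
- exact: measurable_power_bump.
- exact: power_bump_ge0.
have tE : 4 * t = 2 * s ^+ 2 by rewrite s2 /t; field.
rewrite tE; apply: le_trans; last first.
  apply: lee_wpmul2l (power_bump_gauss_ge a1 s0 s1).
  by rewrite lee_fin invr_ge0 powR_ge0.
have p2 : 0 < 2 * pi :> R by rewrite mulr_gt0 ?pi_gt0.
rewrite -EFinM lee_fin.
have -> : 4 * pi * t = 2 * pi * r ^+ 2 by rewrite /t; field.
rewrite mul1r powR12_sqrt; last by rewrite mulr_ge0 ?sqr_ge0// ltW.
rewrite sqrtrM ?(ltW p2)// sqrtr_sqr (ger0_norm (ltW r0)) -/r.
rewrite powRD; last by rewrite gt_eqF ?implybT.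
rewrite powRr1 ?(ltW r0)// /heat_const le_eqVlt; apply/orP; left; apply/eqP.
by field; rewrite !gt_eqF ?sqrtr_gt0.
Qed.

(** The bound [c / (1 - a)] holds for every [a < 1/p]; the supremum over [a] is
    [c / (1 - 1/p)]. *)
Lemma heat_maximal_norm1_ge (p : R) : 1 < p ->
  ((heat_const R * (p / (p - 1)))%:E <= heat_maximal_norm 1 p)%E.
Proof.
move=> p1; have p0 : 0 < p by exact: lt_trans p1.
have c0 : 0 < heat_const R by apply: lt_trans (heat_const_gt R).
have key a : 0 < a -> a < p^-1 ->
    ((heat_const R / (1 - a))%:E <= heat_maximal_norm 1 p)%E.
  move=> a0 ap.
  have ap1 : a * p < 1 by rewrite -ltr_pdivlMr// div1r.
  have a1 : a < 1 by rewrite (lt_trans ap)// invf_lt1.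
  have ac : 0 < 1 - a by rewrite subr_gt0.
  apply: (@heat_maximal_norm_ge _ _ _ _ (radial_power a)) => //.
  - by rewrite divr_ge0 ?ltW.
  - exact: radial_power_Lfun.
  - apply/eqP => N0.
    have := @poweR_Lnorm _ _ _ (lebesgue_euclidean R 1) (EFin \o radial_power a) p.
    rewrite N0 gt_eqF// => /(_ isT); rewrite poweR0r ?gt_eqF//.
    rewrite (_ : (\int[_]_x _ = \int[lebesgue_euclidean R 1]_x (`|radial_power a x| `^ p)%:E)%E).
      rewrite integral_radial_powerX// => /eqP; rewrite eqe => /eqP /esym/eqP.
      by rewrite mulf_eq0 invr_eq0 subr_eq0 !gt_eqF.
    exact: eq_integral.
  - by move=> x; apply: (@heat_maximal_radial_power_ge a p) => //; exact: ltW.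
have q0 : 0 < p^-1 by rewrite invr_gt0.
have q1 : p^-1 < 1 by rewrite invf_lt1.
have h2 : 0 < p^-1 / 2 by rewrite divr_gt0.
have h2q : p^-1 / 2 < p^-1 by lra.
case: (heat_maximal_norm 1 p) key => [b| |] key; last 2 first.
- by rewrite leey.
- by have := key _ h2 h2q.
rewrite lee_fin.
have keyb a : 0 < a -> a < p^-1 -> heat_const R <= b * (1 - a).
  move=> a0 ap; have := key a a0 ap; rewrite lee_fin ler_pdivrMr//.
  by rewrite subr_gt0 (lt_trans ap).
have b0 : 0 < b by have := keyb _ h2 h2q; nra.
have -> : p / (p - 1) = (1 - p^-1)^-1.
  by field; rewrite !gt_eqF ?subr_gt0.
rewrite ler_pdivrMr ?subr_gt0//.
have -> : heat_const R = b * (heat_const R / b) by rewrite mulrCA mulfV ?mulr1// gt_eqF.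
rewrite ler_wpM2l ?(ltW b0)//; set k := heat_const R / b.
have {}keyb a : 0 < a -> a < p^-1 -> k <= 1 - a.
  by move=> a0 ap; rewrite /k ler_pdivrMr// mulrC keyb.
rewrite leNgt; apply/negP => kq.
(* An exponent between max (0, 1 - k) and 1 / p contradicts the bound. *)
pose m := Num.max 0 (1 - k).
have mq : m < p^-1 by rewrite /m gt_max q0/=; lra.
have m0 : 0 <= m by rewrite /m le_max lexx.
have mk : 1 - k <= m by rewrite /m le_max lexx orbT.
have := keyb ((m + p^-1) / 2); lra.
Qed.

End power_bump.

Theorem theorem1p4 (R : realType) :
  (forall (p : R) (d : nat), 1 < p -> (1 <= d)%N ->
     (heat_maximal_norm d.+1 p >= heat_maximal_norm d p)%E) /\
  (exists c : R, 4 / 10 < c /\ c <= 1 /\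
     forall p : R, 1 < p ->
       (heat_maximal_norm 1 p >= (Num.max (c * (p / (p - 1))) 1)%:E)%E) /\
  (forall p : R, 1 < p -> p < 5 / 3 ->
     (heat_maximal_norm 1 p > (2 / 5 * (p / (p - 1)))%:E)%E /\
     2 / 5 * (p / (p - 1)) > 1).
Proof.
split; [|split].
- by move=> p d p1 _; exact: heat_maximal_norm_nondecreasing (ltW p1).
- exists (heat_const R); split; first exact: heat_const_gt.
  split; first exact: heat_const_le1.
  move=> p p1; rewrite EFin_max ge_max heat_maximal_norm1_ge//=.
  apply: le_trans (heat_maximal_norm_nondecreasing 0 (ltW p1)).
  exact: heat_maximal_norm0_ge1 (lt_trans ltr01 p1).
- move=> p p1 p53; have pm : 0 < p - 1 by rewrite subr_gt0.
  have q0 : 0 < p / (p - 1) by rewrite divr_gt0// (lt_trans _ p1).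
  split; last by rewrite mulrA ltr_pdivlMr//; lra.
  apply: lt_le_trans (heat_maximal_norm1_ge p1).
  by rewrite lte_fin ltr_pM2r//; have := heat_const_gt R; lra.
Qed.
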